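(* Let $p$ be a prime, $k\ge1$, $n=p^k$, and let $k^*$ denote the largest proper factor of $k$. Then the Hamming distance of the group $P\Gamma L(2,n)$, acting on $\mathbb{F}_n\cup\{\infty\}$, is $n-p^{k^*}$.
   Context: A proper factor of $k$ is a positive divisor of $k$ smaller than $k$; for $k=1$ take $k^*=0$. $P\Gamma L(2,n)$ is the group of permutations $f$ of $\mathbb{F}_n\cup\{\infty\}$ given, for $a,b,c,d\in\mathbb{F}_n$ with $ad\ne bc$ and $0\le i<k$, by $f(x)=\frac{ax^{p^i}+b}{cx^{p^i}+d}$ if $x\in\mathbb{F}_n$ and $cx^{p^i}+d\neq0$; $f(x)=\infty$ if $x\in\mathbb{F}_n$ and $cx^{p^i}+d=0$; $f(\infty)=a/c$ if $c\ne0$; $f(\infty)=\infty$ if $c=0$. It has $k(n+1)n(n-1)$ elements. The Hamming distance of two permutations is the number of points where they differ; the Hamming distance of a set of permutations is the minimum over pairs of distinct elements.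
   Formalization: The case n = 2 (p = 2, k = 1) is excluded, because there PΓL(2,2) is the symmetric group on 3 points, whose Hamming distance is 2 and not n − p^{k*} = 1. *)

(* Defs.v *)
From mathcomp Require Import all_boot all_algebra all_fingroup.

Set Implicit Arguments.
Unset Strict Implicit.
Unset Printing Implicit Defensive.

Import GRing.Theory.

(* Proper factors are positive and smaller than k. For k = 1 the range is
   empty and the maximum is 0, which is the convention adopted for 1. *)
Definition largest_proper_factor (k : nat) : nat :=
  \max_(d < k | (0 < d) && (d %| k)) d.

Definition perm_dist (T : finType) (s t : {perm T}) : nat :=
  #|[set x | s x != t x]|.

(* The initial value #|T| bounds every perm_dist, so as soon as A has two
   distinct elements this is the minimum over pairs of distinct elements. *)
Definition hamming_distance (T : finType) (A : {set {perm T}}) : nat :=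
  \big[minn/#|T|]_(s in A) \big[minn/#|T|]_(t in A | s != t) perm_dist s t.

Local Open Scope ring_scope.

(* The projective line over F is option F, with None as the point at infinity. *)
Definition semilinear_frac (F : finFieldType) (p i : nat) (a b c d : F)
    (x : option F) : option F :=
  match x with
  | Some x =>
      if c * x ^+ (p ^ i) + d == 0 then None
      else Some ((a * x ^+ (p ^ i) + b) / (c * x ^+ (p ^ i) + d))
  | None => if c == 0 then None else Some (a / c)
  end.

(* Meant for a field F of cardinality p ^ k. *)
Definition PGammaL2 (F : finFieldType) (p k : nat) : {set {perm option F}} :=
  [set f : {perm option F} |
    [exists a : F, exists b : F, exists c : F, exists d : F, exists i : 'I_k,
      (a * d != b * c) &&
      [forall x : option F, f x == semilinear_frac p i a b c d x]]].

(* Main.v *)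
(* Every element of PGammaL(2, n) with exponent i acts on cross-ratios by the
   field automorphism x |-> x ^ (p ^ i).  If two distinct elements agree at
   three points, sending a point to its cross-ratio with these three embeds
   the set where they agree into the projective line over the fixed field of
   a nontrivial power of the Frobenius map; that field has p ^ d elements for
   some proper factor d of k.  The bound is attained, against the identity, by
   x |-> x ^ (p ^ k* ), or by x |-> a x with a different from 0 and 1
   when k = 1. *)
Require Import Defs.
From mathcomp Require Import all_boot all_algebra all_fingroup.
From mathcomp Require Import order finfield ring.

Set Implicit Arguments.
Unset Strict Implicit.
Unset Printing Implicit Defensive.

Import GRing.Theory.

(** * Bounding the minimum distance through pairs of permutations *)

Section HammingDistance.

Variables (T : finType) (A : {set {perm T}}).

Lemma hamming_distance_le (s t : {perm T}) :
  s \in A -> t \in A -> s != t -> hamming_distance A <= perm_dist s t.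
Proof.
move=> sA tA st; rewrite /hamming_distance.
apply: leq_trans (@Order.TotalTheory.bigmin_le_cond _ nat _ _ s _ _ sA) _.
have Pt : (t \in A) && (s != t) by rewrite tA.
exact: (@Order.TotalTheory.bigmin_le_cond _ nat _ _ t _ _ Pt).
Qed.

(** The bound [m <= #|T|] covers the initial value of both nested minima. *)
Lemma hamming_distance_ge m :
  m <= #|T| ->
  (forall s t, s \in A -> t \in A -> s != t -> m <= perm_dist s t) ->
  m <= hamming_distance A.
Proof.
have min_ge x y : m <= x -> m <= y -> m <= minn x y by rewrite leq_min => -> ->.
move=> mT mA; apply: (big_ind (leq m)) => // s sA.
by apply: (big_ind (leq m)) => // t /andP[tA st]; apply: mA.
Qed.

Lemma perm_distE (s t : {perm T}) :
  perm_dist s t = #|T| - #|[set x | s x == t x]|.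
Proof.
rewrite /perm_dist -(cardsC [set x | s x == t x]) addKn.
by apply: eq_card => x; rewrite !inE.
Qed.

End HammingDistance.

(** * Frobenius powers and their fixed points *)

Section Frobenius.

Local Open Scope ring_scope.

Lemma exprB_pchar (R : comNzRingType) (p i : nat) (x y : R) :
  p \in [pchar R] -> (x - y) ^+ (p ^ i) = x ^+ (p ^ i) - y ^+ (p ^ i).
Proof.
move=> pR.
have pn : [pchar R].-nat (p ^ i)%N by rewrite pnatX pnatE ?pR // (pcharf_prime pR).
by rewrite exprDn_pchar // exprNn_pchar.
Qed.

Lemma expr_pchar_inj (R : idomainType) (p i : nat) :
  p \in [pchar R] -> injective (fun x : R => x ^+ (p ^ i)).
Proof.
move=> pR x y /= /eqP; rewrite -subr_eq0 -exprB_pchar // expf_eq0 subr_eq0.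
by case/andP=> _ /eqP.
Qed.

Lemma size_XnsubX (R : nzRingType) n : (1 < n)%N ->
  size ('X^n - 'X : {poly R}) = n.+1.
Proof. by move=> n1; rewrite size_polyDl size_polyXn // size_polyN size_polyX. Qed.

(** The fixed points are roots of ['X^n - 'X], which has degree [n]. *)
Lemma card_fix_le (F : finFieldType) n : (1 < n)%N ->
  (#|[set c : F | c ^+ n == c]| <= n)%N.
Proof.
move=> n1; rewrite -ltnS -(size_XnsubX F n1) cardE.
apply: max_poly_roots; last exact: enum_uniq.
- by rewrite -size_poly_eq0 size_XnsubX.
apply/allP=> c; rewrite mem_enum inE => /eqP cn.
by rewrite /root !hornerE cn subrr.
Qed.

(* The divisibility condition makes 'X^n - 'X a factor of 'X^#|F| - 'X, which
   splits into distinct linear factors. *)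
Lemma card_fix_ge (F : finFieldType) n : (1 < n)%N -> (n.-1 %| #|F|.-1)%N ->
  (n <= #|[set c : F | c ^+ n == c]|)%N.
Proof.
move=> n1 /dvdnP[q Eq].
have XE m : (0 < m)%N -> 'X^m - 'X = 'X * ('X^(m.-1) - 1) :> {poly F}.
  by case: m => // m _; rewrite mulrBr mulr1 -exprS.
have : ('X^n - 'X : {poly F}) %| 'X^#|F| - 'X.
  rewrite !XE ?(ltnW n1) // ?(ltnW (card_finNzRing_gt1 F)) //.
  by rewrite dvdp_mul2l ?polyX_eq0 // Eq mulnC exprM (subrX1 'X^(n.-1)) dvdp_mulr.
rewrite finField_genPoly => /dvdp_prod_XsubC[m].
set s := mask _ _ => /[dup] /eqp_size; rewrite size_XnsubX // size_prod_XsubC.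
case=> n_s /eqp_root rt.
rewrite n_s cardE; apply: uniq_leq_size.
  by apply: mask_uniq; rewrite /index_enum -enumT enum_uniq.
move=> c cs; rewrite mem_enum inE -n_s.
by have := rt c; rewrite root_prod_XsubC cs /root !hornerE subr_eq0.
Qed.

Lemma expr_expn_iter (R : pzSemiRingType) (x : R) q t : x ^+ q = x -> x ^+ (q ^ t) = x.
Proof. by move=> xq; elim: t => [|t IH]; rewrite ?expn0 // expnS exprM xq. Qed.

(** By Bezout, a multiple of [m] is a multiple of [k] plus the gcd; both fixing equations are
    iterated accordingly. *)
Lemma expr_gcdn_fix (R : pzSemiRingType) (x : R) p m k : (0 < m)%N ->
  x ^+ (p ^ m) = x -> x ^+ (p ^ k) = x -> x ^+ (p ^ gcdn m k) = x.
Proof.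
move=> m0 xm xk; have [a b E _] := egcdnP k m0.
have := expr_expn_iter a xm.
by rewrite -expnM mulnC E expnD exprM [(b * k)%N]mulnC expnM (expr_expn_iter b xk).
Qed.

End Frobenius.

Lemma largest_proper_factor_ge k d :
  0 < d < k -> d %| k -> d <= largest_proper_factor k.
Proof.
case/andP=> d0 dk d_k.
by apply: (@leq_bigmax_cond _ _ (fun i : 'I_k => val i) (Ordinal dk)); rewrite /= d0.
Qed.

Lemma largest_proper_factorP k : 1 < k ->
  0 < largest_proper_factor k < k /\ largest_proper_factor k %| k.
Proof.
move=> k1.
(* The factor 1 makes the range nonempty, so the maximum is attained. *)
have P1 : (0 < Ordinal k1) && (Ordinal k1 %| k) by rewrite dvd1n.
rewrite /largest_proper_factor (bigop.bigmax_eq_arg (Ordinal k1)) //.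
by case: arg_maxnP => //= i /andP[-> ->] _; rewrite ltn_ord.
Qed.

(** * Homogeneous coordinates and cross-ratios *)

Section ProjectiveLine.

Local Open Scope ring_scope.

Variable F : fieldType.
Implicit Types x y : option F.

Definition hom_coord x : F * F := if x is Some u then (u, 1) else (1, 0).

Definition hdet x y : F :=
  (hom_coord x).1 * (hom_coord y).2 - (hom_coord x).2 * (hom_coord y).1.

Lemma hdet_eq0 x y : (hdet x y == 0) = (x == y).
Proof.
case: x y => [u|] [v|]; rewrite /hdet /=.
- by rewrite mulr1 mul1r subr_eq0.
- by rewrite mulr0 mul1r sub0r oppr_eq0 oner_eq0.
- by rewrite mulr1 mul0r subr0 oner_eq0.
- by rewrite mulr0 mul0r subr0 !eqxx.
Qed.

(** Used to turn an equality of cross-ratios into the vanishing of [hdet x y]. *)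
Lemma hdet_plucker (x1 x2 x y : option F) :
  hdet x x1 * hdet y x2 - hdet y x1 * hdet x x2 = hdet x y * hdet x1 x2.
Proof. rewrite /hdet; ring. Qed.

(** The point with homogeneous coordinates [(r : s)]. *)
Definition of_ratio (r s : F) : option F := if s == 0 then None else Some (r / s).

(** Normalised to send distinct [x1], [x2], [x3] to 0, infinity and 1. *)
Definition cross_ratio x1 x2 x3 x : option F :=
  of_ratio (hdet x x1 * hdet x3 x2) (hdet x x2 * hdet x3 x1).

Lemma of_ratio_scale (l r s : F) : l != 0 -> of_ratio (l * r) (l * s) = of_ratio r s.
Proof.
move=> l0; rewrite /of_ratio mulf_eq0 (negPf l0) /=; case: ifP => // /negbT s0.
by rewrite -mulf_div divff // mul1r.
Qed.

Lemma cross_ratio_inj (x1 x2 x3 : option F) :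
  x1 != x2 -> x2 != x3 -> x3 != x1 -> injective (cross_ratio x1 x2 x3).
Proof.
rewrite (eq_sym x2) -!hdet_eq0 => d12 d32 d31 x y.
rewrite /cross_ratio /of_ratio !mulf_eq0 (negPf d31) !orbF.
case: ifP => [|/negbT dx]; case: ifP => [|/negbT dy] //.
  by rewrite !hdet_eq0 => /eqP-> /eqP->.
case=> /eqP; rewrite eqr_div ?mulf_neq0 // => /eqP E.
(* By [hdet_plucker], this is the cross-multiplied equality [E] rearranged. *)
have : hdet x y * hdet x1 x2 * (hdet x3 x2 * hdet x3 x1) = 0.
  rewrite -hdet_plucker mulrBl; apply/eqP; rewrite subr_eq0; apply/eqP.
  transitivity (hdet x x1 * hdet x3 x2 * (hdet y x2 * hdet x3 x1)); first by ring.
  by rewrite E; ring.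
move/eqP; rewrite !mulf_eq0 (negPf d12) (negPf d31) (negPf d32).
by rewrite !orbF hdet_eq0 => /eqP.
Qed.

End ProjectiveLine.

(** * Action of semilinear fractional maps on cross-ratios *)

Section SemilinearFrac.

Local Open Scope ring_scope.

Variables (F : finFieldType) (p : nat).
Hypothesis pF : p \in [pchar F].

Let p_gt0 i : (0 < p ^ i)%N.
Proof. by rewrite expn_gt0 prime_gt0 ?(pcharf_prime pF). Qed.

Variables (i : nat) (a b c d : F).
Hypothesis ad_bc : a * d != b * c.

(** On homogeneous coordinates the map is a Frobenius power followed by a matrix; [l] is the scalar
    lost in normalising the image. This absorbs all cases at infinity. *)
Lemma hom_coord_semilinear_frac x : exists2 l : F, l != 0 &
  let u := hom_coord x in let v := hom_coord (semilinear_frac p i a b c d x) in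
  l * v.1 = a * u.1 ^+ (p ^ i) + b * u.2 ^+ (p ^ i) /\
  l * v.2 = c * u.1 ^+ (p ^ i) + d * u.2 ^+ (p ^ i).
Proof.
case: x => [u|] /=.
  rewrite !expr1n !mulr1.
  case: ifP => [/eqP E|/negbT E]; last first.
    by exists (c * u ^+ (p ^ i) + d) => //=; rewrite mulrC divfK ?mulr1.
  exists (a * u ^+ (p ^ i) + b) => //=; last by rewrite E mulr1 mulr0.
  (* Numerator and denominator cannot both vanish: [a * d - b * c] is a combination of them. *)
  apply: contra ad_bc => /eqP E'; rewrite -subr_eq0; apply/eqP.
  set w := u ^+ _ in E E'.
  have -> : a * d - b * c = a * (c * w + d) - c * (a * w + b) by ring.
  by rewrite E E' !mulr0 subrr.
rewrite expr1n expr0n eqn0Ngt p_gt0 /= !mulr1 !mulr0 !addr0.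
case: ifP => [/eqP c0|/negbT c0].
  exists a => /=; last by rewrite mulr1 mulr0 c0.
  by apply: contra ad_bc => /eqP->; rewrite c0 mul0r mulr0.
by exists c => //=; rewrite mulr1 mulrC divfK.
Qed.

Lemma cross_ratio_semilinear_frac x1 x2 x3 x :
  let f := semilinear_frac p i a b c d in
  cross_ratio (f x1) (f x2) (f x3) (f x) =
  omap (fun r => r ^+ (p ^ i)) (cross_ratio x1 x2 x3 x).
Proof.
move=> f.
pose scales (l : F) z := let u := hom_coord z in let v := hom_coord (f z) in
  l * v.1 = a * u.1 ^+ (p ^ i) + b * u.2 ^+ (p ^ i) /\
  l * v.2 = c * u.1 ^+ (p ^ i) + d * u.2 ^+ (p ^ i).
have hdet_f (z w : option F) (l m : F) : scales l z -> scales m w ->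
    l * m * hdet (f z) (f w) = (a * d - b * c) * hdet z w ^+ (p ^ i).
  move=> [Ez1 Ez2] [Ew1 Ew2].
  rewrite [hdet (f z) _]/hdet.
  have -> (u1 u2 v1 v2 : F) : l * m * (u1 * v2 - u2 * v1)
      = (l * u1) * (m * v2) - (l * u2) * (m * v1) by ring.
  by rewrite Ez1 Ez2 Ew1 Ew2 /hdet exprB_pchar // !exprMn; ring.
have [l l0 El] := hom_coord_semilinear_frac x.
have [l1 l10 El1] := hom_coord_semilinear_frac x1.
have [l2 l20 El2] := hom_coord_semilinear_frac x2.
have [l3 l30 El3] := hom_coord_semilinear_frac x3.
(* Numerator and denominator each involve all four points once, so one common factor clears the
   scalars of both. *)
rewrite /cross_ratio -(@of_ratio_scale _ (l * l1 * (l3 * l2))) ?mulf_neq0 //.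
have -> (r s : F) : l * l1 * (l3 * l2) * (r * s) = (l * l1 * r) * (l3 * l2 * s) by ring.
have -> (r s : F) : l * l1 * (l3 * l2) * (r * s) = (l * l2 * r) * (l3 * l1 * s) by ring.
rewrite !hdet_f //.
have sqD (D r s : F) :
    D * r ^+ (p ^ i) * (D * s ^+ (p ^ i)) = (D * D) * (r * s) ^+ (p ^ i).
  by rewrite exprMn; ring.
rewrite !sqD.
rewrite of_ratio_scale; last by rewrite mulf_neq0 // subr_eq0.
rewrite /of_ratio expf_eq0 p_gt0 /=; case: ifP => //= _.
by rewrite expr_div_n.
Qed.

End SemilinearFrac.

Section PGammaL2.

Variables (p k : nat) (F : finFieldType).
Hypotheses (p_prime : prime p) (cardF : #|F| = p ^ k).

Let pF : p \in [pchar F]%R. Proof. exact: card_finPcharP cardF p_prime. Qed.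

(** Cancelling the injective power [p ^ i] shows that [c] is fixed by the exponent [p ^ (j - i)],
    and also by [p ^ k], hence by [p ^ gcdn (j - i) k]; this gcd is a proper factor of [k]. *)
Lemma card_frobenius_eq_le i j : i < j < k ->
  #|[set c : F | c ^+ (p ^ i) == c ^+ (p ^ j)]%R| <= p ^ largest_proper_factor k.
Proof.
case/andP=> ij jk; set m := j - i.
have m0 : 0 < m by rewrite subn_gt0.
have mk : m < k by apply: leq_ltn_trans jk; apply: leq_subr.
have g0 : 0 < gcdn m k by rewrite gcdn_gt0 m0.
have gk : gcdn m k < k by apply: leq_ltn_trans mk; apply: dvdn_leq (dvdn_gcdl _ _).
apply: (@leq_trans (p ^ gcdn m k)); last first.
  by rewrite leq_exp2l ?prime_gt1 // largest_proper_factor_ge ?g0 ?dvdn_gcdr.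
apply: leq_trans (card_fix_le F _); last first.
  by rewrite -{1}(expn0 p) ltn_exp2l ?prime_gt1.
apply/subset_leq_card/subsetP => c; rewrite !inE => /eqP E; apply/eqP.
apply: expr_gcdn_fix => //; last by rewrite -cardF expf_card.
apply: (expr_pchar_inj pF (i := i)) => /=.
by rewrite -exprM -expnD subnK ?(ltnW ij).
Qed.

Lemma card_agree_le (s t : {perm option F}) :
  s \in PGammaL2 F p k -> t \in PGammaL2 F p k -> s != t ->
  #|[set x | s x == t x]| <= (p ^ largest_proper_factor k).+1.
Proof.
rewrite !inE.
move=> /existsP[a /existsP[b /existsP[c /existsP[d /existsP[i /andP[dn /forallP Es]]]]]].
move=> /existsP[a' /existsP[b' /existsP[c' /existsP[d' /existsP[j /andP[dn' /forallP Et]]]]]].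
move=> st.
have [card2|] := leqP #|[set x | s x == t x]| 2.
  by apply: leq_trans card2 _; rewrite ltnS expn_gt0 prime_gt0.
case/card_gt2P => x1 [x2 [x3 [[]]]]; rewrite !inE => /eqP e1 /eqP e2 /eqP e3.
case=> n12 n23 n31.
pose cr := cross_ratio x1 x2 x3.
have crs x : cross_ratio (s x1) (s x2) (s x3) (s x)
    = omap (fun r => r ^+ (p ^ i))%R (cr x).
  by rewrite !(eqP (Es _)) cross_ratio_semilinear_frac.
have crt x : cross_ratio (s x1) (s x2) (s x3) (t x)
    = omap (fun r => r ^+ (p ^ j))%R (cr x).
  by rewrite e1 e2 e3 !(eqP (Et _)) cross_ratio_semilinear_frac.
(* With equal exponents, [s] and [t] give every point the same cross-ratio, so they coincide. *)
have [ij|ij] := eqVneq (i : nat) j.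
  case/eqP: st; apply/permP => x.
  apply: (@cross_ratio_inj F (s x1) (s x2) (s x3)); rewrite ?(inj_eq perm_inj) //.
  by rewrite crs crt ij.
have fixle : #|[set r : F | r ^+ (p ^ i) == r ^+ (p ^ j)]%R| <= p ^ largest_proper_factor k.
  case: (ltngtP i j) ij => // ij _; first by rewrite card_frobenius_eq_le ?ij ?ltn_ord.
  rewrite (eq_card (B := [set r : F | r ^+ (p ^ j) == r ^+ (p ^ i)]%R)).
    by rewrite card_frobenius_eq_le ?ij ?ltn_ord.
  by move=> r; rewrite !inE eq_sym.
set Fix := [set r : F | _] in fixle.
have cr_inj : injective cr by apply: cross_ratio_inj.
rewrite -(card_imset _ cr_inj).
(* Agreement at [x] puts its cross-ratio in [Fix] or at infinity, which accounts for the successor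
   in the bound. *)
apply: (@leq_trans #|None |: Some @: Fix|).
  apply/subset_leq_card/subsetP => _ /imsetP[x + ->]; rewrite inE => /eqP stx.
  have := crs x; rewrite stx crt; case: (cr x) => [r|] /=; last by rewrite setU11.
  case=> E; rewrite !inE /= (mem_imset _ _ Some_inj) inE.
  by rewrite E.
by rewrite (leq_trans (leq_card_setU _ _)) // cards1 add1n ltnS card_imset // => ? ? [].
Qed.

Lemma mem_PGammaL2_omap (e : {perm option F}) (a : F) (i : nat) :
  (a != 0)%R -> i < k -> (forall x, e x = omap (fun u => a * u ^+ (p ^ i))%R x) ->
  e \in PGammaL2 F p k.
Proof.
move=> a0 ik eE; rewrite inE; apply/existsP; exists a; apply/existsP; exists 0%R.
apply/existsP; exists 0%R; apply/existsP; exists 1%R.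
apply/existsP; exists (Ordinal ik); rewrite mulr1 mul0r a0; apply/forallP => x.
rewrite eE /semilinear_frac; case: x => [u|] /=; last by rewrite eqxx.
by rewrite mul0r add0r oner_eq0 addr0 divr1.
Qed.

(* The fixed point at infinity compensates for the p ^ k + 1 points of the line. *)
Lemma hamming_distance_PGammaL2_le (a : F) (i m : nat) :
  let h := (fun u => a * u ^+ (p ^ i))%R in
  (a != 0)%R -> i < k -> (exists u, h u != u) ->
  m <= #|[set u | h u == u]| ->
  hamming_distance (PGammaL2 F p k) <= p ^ k - m.
Proof.
move=> h a0 ik [u hu] m_le.
have h_inj : injective h.
  by move=> x y /(mulfI a0); apply: (expr_pchar_inj pF).
pose e := perm (inj_omap h_inj).
have e1 : e != 1%g.
  apply: contra hu => /eqP/permP/(_ (Some u)); rewrite perm1 permE /=.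
  by case=> ->.
have eP : e \in PGammaL2 F p k.
  by apply: (mem_PGammaL2_omap a0 ik) => x; rewrite permE.
have oneP : 1%g \in PGammaL2 F p k.
  apply: (@mem_PGammaL2_omap _ 1%R 0); rewrite ?oner_eq0 ?(leq_trans _ ik) //.
  by case=> [x|]; rewrite perm1 //= mul1r expr1.
apply: leq_trans (hamming_distance_le eP oneP e1) _.
rewrite perm_distE card_option cardF -[p ^ k - m]subSS leq_sub2l //.
apply: (@leq_trans #|None |: Some @: [set u | h u == u]|).
  rewrite cardsU1 card_imset; last exact: Some_inj.
  rewrite (_ : None \in _ = false) ?add1n ?ltnS //.
  by apply/imsetP => -[].
apply/subset_leq_card/subsetP => x; rewrite !inE perm1 permE.
by case/orP=> [/eqP->//|/imsetP[v]]; rewrite inE => /eqP hv -> /=; rewrite hv.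
Qed.

End PGammaL2.

Theorem theorem2 (p k : nat) (F : finFieldType) (p_prime : prime p)
    (k_ge1 : 1 <= k) (cardF : #|F| = p ^ k) (n_neq2 : p ^ k <> 2) :
  hamming_distance (PGammaL2 F p k) = p ^ k - p ^ largest_proper_factor k.
Proof.
apply/eqP; rewrite eqn_leq; apply/andP; split; last first.
  apply: hamming_distance_ge => [|s t sP tP st].
    by rewrite card_option cardF (leq_trans (leq_subr _ _)).
  by rewrite perm_distE card_option cardF -[p ^ k - _]subSS leq_sub2l // card_agree_le.
have [k1|k1] := ltnP 1 k.
  have [/andP[d0 dk] d_k] := largest_proper_factorP k1.
  set d := largest_proper_factor k in d0 dk d_k *.
  have pd1 : 1 < p ^ d by rewrite -{1}(expn0 p) ltn_exp2l ?prime_gt1.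
  have fixE : [set u : F | 1 * u ^+ (p ^ d) == u]%R = [set u | u ^+ (p ^ d) == u]%R.
    by apply/setP => u; rewrite !inE mul1r.
  apply: (@hamming_distance_PGammaL2_le p k F p_prime cardF 1%R d) => //.
  - exact: oner_neq0.
  (* If every element were fixed, the field would have at most [p ^ d] elements, against [d < k]. *)
  - apply/existsP; apply: contraLR dk => /existsPn fixall; rewrite -leqNgt.
    rewrite -(leq_exp2l _ _ (prime_gt1 p_prime)) -cardF.
    apply: leq_trans (card_fix_le F pd1); rewrite -cardsT.
    apply/subset_leq_card/subsetP => u _; rewrite inE.
    by have := fixall u; rewrite negbK mul1r.
  (* With [q = p ^ d], [q - 1] divides [q ^ (k %/ d) - 1]. *)
  - rewrite fixE card_fix_ge // cardF -(divnK d_k) mulnC expnM.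
    exact: dvdn_pred_predX.
have ek : k = 1 by apply/eqP; rewrite eqn_leq k1.
have lpf : largest_proper_factor k = 0.
  by rewrite /largest_proper_factor ek big1 // => -[[]].
(* A scalar other than 0 and 1 exists because the field does not have two elements; this is where
   [n_neq2] enters. *)
have : 0 < #|~: [set 0; 1]%R :> {set F}|.
  rewrite cardsCs setCK cards2 eq_sym oner_eq0 cardF subn_gt0.
  rewrite ltn_neqAle eq_sym; apply/andP; split; first exact/eqP.
  by rewrite ek expn1 prime_gt1.
case/card_gt0P=> a; rewrite !inE negb_or => /andP[a0 a1].
rewrite lpf.
(* Multiplication by [a] moves 1 and fixes 0, which supplies the single finite fixed point [p ^ 0]
   asks for. *)
apply: (@hamming_distance_PGammaL2_le p k F p_prime cardF a 0) => //.
  by exists 1%R; rewrite mulr1.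
by apply/card_gt0P; exists 0%R; rewrite inE mulr0.
Qed.
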